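(* (1) Let $f \colon \Omega_\kappa \to \mathbb{R}$ be a function such that $|f(\omega) - f(\tau_{ij}\omega)| \le c_{ij}$ for all $\omega \in \Omega_\kappa$, all $1 \le i < j \le N$ and suitable constants $c_{ij} \ge 0$. Then for any $t \ge 0$, $$\mathbb{P}_\kappa (f - \mathbb{E}_\kappa f \ge t) \le \exp\Big(- \frac{Nt^2}{4\sum_{1 \le i < j \le N}c_{ij}^2}\Big).$$ (2) Let $f \colon [x_1, x_L]^N \to \mathbb{R}$ be convex and $1$-Lipschitz (with respect to the Euclidean norm). Then for any $t \ge 0$, $$\mathbb{P}_\kappa (f-\mathbb{E}_\kappa f \ge t) \le \exp\Big(-\frac{t^2}{16|\mathcal{X}|^2}\Big).$$
   Context: Let $L \ge 2$ be an integer, $\kappa = (\kappa_1,\ldots,\kappa_L)$ a vector of positive integers, $N = \kappa_1 + \cdots + \kappa_L$, and $\mathcal{X} = \{x_1,\ldots,x_L\} \subset \mathbb{R}$ a set of $L$ distinct reals ordered $x_1 < \cdots < x_L$; $|\mathcal{X}| := x_L - x_1$ denotes its diameter. The multislice is $$\Omega_\kappa = \Big\{\omega = (\omega_1,\ldots,\omega_N) \in \mathcal{X}^N : \#\{i : \omega_i = x_\ell\} = \kappa_\ell \text{ for } \ell = 1,\ldots,L\Big\}.$$ $\mathbb{P}_\kappa$ is the uniform distribution on $\Omega_\kappa$ and $\mathbb{E}_\kappa$ the expectation under it. For $i \neq j$, $\tau_{ij}\omega$ is the vector obtained from $\omega$ by exchanging its $i$-th and $j$-th components. *)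

(* Defs.v *)
From HB Require Import structures.
From mathcomp Require Import all_boot all_order all_algebra finmap.
From mathcomp Require Import all_classical all_reals all_analysis.

Set Implicit Arguments.
Unset Strict Implicit.
Unset Printing Implicit Defensive.

Import Order.TTheory GRing.Theory Num.Theory.
Local Open Scope fset_scope.
Local Open Scope ring_scope.

Section UniformDistribution.
Context {R : realType} {T : choiceType}.

Definition unif_prob (S : {fset T}) (A : pred T) : R :=
  #|` [fset w in S | A w]|%:R / #|` S|%:R.

Definition unif_expect (S : {fset T}) (f : T -> R) : R :=
  (\sum_(w <- S) f w) / #|` S|%:R.

End UniformDistribution.

Section Multislice.
Context {R : realType} {L : nat}.

(* The vectors of [X ^ N] for [X] the range of [x]. *)
Definition vectors_over (N : nat) (x : 'I_L -> R) : {fset 'rV[R]_N} :=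
  [fset \row_i x (s i) | s : {ffun 'I_N -> 'I_L} in predT].

Definition multislice (N : nat) (kappa : 'I_L -> nat) (x : 'I_L -> R) :
    {fset 'rV[R]_N} :=
  [fset w in vectors_over N x |
    [forall l : 'I_L, #|[set i : 'I_N | w 0 i == x l]| == kappa l]].

(* The indices 1 and L of the mathematical notation, shifted to start at 0. *)
Definition idx_first (hL : (2 <= L)%N) : 'I_L := Ordinal (ltnW hL).
Definition idx_last (hL : (2 <= L)%N) : 'I_L := rev_ord (idx_first hL).

(* The diameter of the range of [x] when [x] is increasing. *)
Definition diam (hL : (2 <= L)%N) (x : 'I_L -> R) : R :=
  x (idx_last hL) - x (idx_first hL).

End Multislice.

Section Euclidean.
Context {R : realType} {N : nat}.

Definition cube (a b : R) : set 'rV[R]_N :=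
  [set v | forall i, a <= v 0 i <= b]%classic.

(* The library norm on ['rV[R]_N] is the sup norm, hence this definition. *)
Definition enorm (v : 'rV[R]_N) : R := Num.sqrt (\sum_i v 0 i ^+ 2).

Definition elipschitz1 (D : set 'rV[R]_N) (f : 'rV[R]_N -> R) : Prop :=
  forall v w, D v -> D w -> `|f v - f w| <= enorm (v - w).

End Euclidean.

(* Main.v *)
Require Import Defs.
From HB Require Import structures.
From mathcomp Require Import all_boot all_order all_algebra all_fingroup finmap.
From mathcomp Require Import all_classical all_reals all_analysis.
From mathcomp Require Import ring lra.

(** A uniform point of the multislice is [col_perm s w0] with [s] a uniform
    permutation and [w0] any point of the multislice, and exchanging the
    components [i] and [j] is multiplying [s] on the left by [tperm i j]. So
    both parts are concentration inequalities on the symmetric group, and both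
    come from one modified logarithmic Sobolev inequality for random
    transpositions ([mlsi_transpo]):
      ent g <= 1 / (2 n) sum_(i, j) E (g - g_ij) (ln g - ln g_ij),
    where g_ij(s) = g(tperm i j * s). It is proved by induction on [n]: the
    chain rule splits the entropy into the entropies given the value [s i],
    which the induction hypothesis controls, and the entropy of the
    conditional mean of [g] given [s i], a function of a uniform point, for
    which Jensen suffices. Permutations with [s i = a] and with [s i = b] are
    coupled by multiplying by [tperm a b], and the joint convexity of
    (x - y) (ln x - ln y) moves the bound from the conditional means to [g].
    Averaging over the revealed position [i] gives the constant.

    Applied to g = exp (l F), the inequality reads ent g <= K l^2 E g as soon
    as the increments of F are controlled, and the Herbst argument ([herbst])
    turns this into E exp (l (F - E F)) <= exp (K l^2), whence the tail
    exp (- t^2 / (4 K)).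

    For the first part (e^a - e^b) (a - b) <= (a - b)^2 (e^a + e^b) / 2 gives
    K = sum_(i < j) c_ij^2 / N. For the second part only the descents
    d_ij = max (f w - f (xcol i j w)) 0 matter. By convexity, moving from [w]
    in the direction sum_(i, j) d_ij (xcol i j w - w) decreases [f] at a rate
    of at least sum_(i, j) d_ij^2, while the Lipschitz condition bounds this
    rate by the Euclidean length of the direction, at most
    2 sqrt N |X| (sum_(i, j) d_ij^2)^(1/2). So sum_(i, j) d_ij^2 <= 4 N |X|^2
    ([sum_sqr_descent]), which gives K = 4 |X|^2. *)

Set Implicit Arguments.
Unset Strict Implicit.
Unset Printing Implicit Defensive.

Import Order.TTheory GRing.Theory Num.Theory.
Local Open Scope ring_scope.

(** * Means and entropies on a finite set *)

Section Mean.
Context {R : realType}.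

Definition mean (T : finType) (f : T -> R) : R := (\sum_t f t) / #|T|%:R.

Lemma eq_mean (T : finType) (f g : T -> R) : f =1 g -> mean f = mean g.
Proof. by move=> fg; rewrite /mean; congr (_ / _); apply: eq_bigr. Qed.

Lemma ler_mean (T : finType) (f g : T -> R) :
  (forall t, f t <= g t) -> mean f <= mean g.
Proof. by move=> fg; rewrite ler_wpM2r ?invr_ge0 ?ler0n// ler_sum. Qed.

Lemma mean_ge0 (T : finType) (f : T -> R) : (forall t, 0 <= f t) -> 0 <= mean f.
Proof. by move=> f0; rewrite divr_ge0 ?ler0n// sumr_ge0. Qed.

Lemma meanD (T : finType) (f g : T -> R) :
  mean (fun t => f t + g t) = mean f + mean g.
Proof. by rewrite /mean big_split mulrDl. Qed.

Lemma meanN (T : finType) (f : T -> R) : mean (fun t => - f t) = - mean f.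
Proof. by rewrite /mean sumrN mulNr. Qed.

Lemma meanB (T : finType) (f g : T -> R) :
  mean (fun t => f t - g t) = mean f - mean g.
Proof. by rewrite meanD meanN. Qed.

Lemma meanZ (T : finType) (c : R) (f : T -> R) :
  mean (fun t => c * f t) = c * mean f.
Proof. by rewrite /mean -mulr_sumr mulrA. Qed.

Lemma meanZr (T : finType) (c : R) (f : T -> R) :
  mean (fun t => f t * c) = mean f * c.
Proof. by rewrite mulrC -meanZ; apply: eq_mean => t; rewrite mulrC. Qed.

Lemma mean_cst (T : finType) (c : R) : (0 < #|T|)%N -> mean (fun _ : T => c) = c.
Proof.
move=> T0; rewrite /mean sumr_const -[c *+ _]mulr_natr mulfK//.
by rewrite pnatr_eq0 -lt0n.
Qed.

Lemma mean_sum (T : finType) (I : Type) (r : seq I) (P : pred I)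
    (F : I -> T -> R) :
  mean (fun t => \sum_(i <- r | P i) F i t) = \sum_(i <- r | P i) mean (F i).
Proof. by rewrite /mean exchange_big mulr_suml. Qed.

Lemma exchange_mean (T U : finType) (F : T -> U -> R) :
  mean (fun t => mean (F t)) = mean (fun u => mean (F^~ u)).
Proof.
rewrite /mean -!mulr_suml exchange_big -!mulrA; congr (_ * _).
exact: mulrC.
Qed.

Lemma reindex_mean (T : finType) (h : T -> T) (f : T -> R) :
  injective h -> mean f = mean (f \o h).
Proof. by move=> h_inj; rewrite /mean (reindex_inj h_inj). Qed.

Lemma mean_gt0 (T : finType) (f : T -> R) :
  (0 < #|T|)%N -> (forall t, 0 < f t) -> 0 < mean f.
Proof.
move=> T0 f0; rewrite divr_gt0 ?ltr0n//.
case/card_gt0P: T0 => t0 _; rewrite (bigD1 t0)//= ltr_pwDl// sumr_ge0// => t _.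
exact: ltW.
Qed.

(** Concavity of the logarithm in the form of its tangent line at [m]. *)
Lemma ln_le_tangent (u m : R) : 0 < u -> 0 < m -> ln u <= ln m + u / m - 1.
Proof.
move=> u0 m0; have um0 : 0 < u / m by rewrite divr_gt0.
have : ln (1 + (u / m - 1)) <= u / m - 1 by apply: le_ln1Dx; lra.
rewrite addrC subrK ln_div ?posrE//; lra.
Qed.

(** Jensen for the logarithm, from the tangent line at the mean of [g]. *)
Lemma mean_ln_le (T : finType) (g : T -> R) :
  (0 < #|T|)%N -> (forall t, 0 < g t) ->
  mean (fun t => ln (g t)) <= ln (mean g).
Proof.
move=> T0 g0; have m0 := mean_gt0 T0 g0.
rewrite (_ : ln (mean g) =
  mean (fun t => (ln (mean g) - 1) + g t * (mean g)^-1)); last first.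
  by rewrite meanD mean_cst// meanZr divff ?gt_eqF// subrK.
by apply: ler_mean => t; have := ln_le_tangent (g0 t) m0; lra.
Qed.

(** The log-sum inequality: relative entropy decreases under averaging. *)
Lemma log_sum (T : finType) (u v : T -> R) :
  (0 < #|T|)%N -> (forall t, 0 < u t) -> (forall t, 0 < v t) ->
  mean u * (ln (mean u) - ln (mean v)) <=
  mean (fun t => u t * (ln (u t) - ln (v t))).
Proof.
move=> T0 u0 v0.
have U0 := mean_gt0 T0 u0; have V0 := mean_gt0 T0 v0.
set U := mean u in U0 *; set V := mean v in V0 *.
(* Pointwise, bound the logarithm of (v t / u t) (U / V) by its tangent at 1;
   the linear terms cancel on average. *)
rewrite (_ : U * _ = mean (fun t =>
    u t * (ln U - ln V + 1) - v t * (U / V))); last first.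
  by rewrite meanB !meanZr -/U -/V; field; exact: lt0r_neq0.
clearbody U V; apply: ler_mean => t.
have z0 : 0 < v t * U by rewrite mulr_gt0.
have w0 : 0 < u t * V by rewrite mulr_gt0.
have := ln_le_tangent z0 w0.
rewrite !lnM ?posrE// => /(ler_wpM2l (ltW (u0 t))).
rewrite (_ : u t * (_ + _ - 1) = u t * (ln (u t) + ln V) + v t * (U / V) - u t).
  nra.
by field; rewrite !lt0r_neq0.
Qed.

(** The integrand of the Dirichlet form of [g] against [ln g]. *)
Definition gap (x y : R) : R := (x - y) * (ln x - ln y).

Lemma gapxx (x : R) : gap x x = 0. Proof. by rewrite /gap !subrr mul0r. Qed.

Lemma gap_ge0 (x y : R) : 0 < x -> 0 < y -> 0 <= gap x y.
Proof.
move=> x0 y0; rewrite /gap; case: (lerP x y) => [xy|/ltW xy].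
  by rewrite mulr_le0 ?subr_le0// ler_ln ?posrE.
by rewrite mulr_ge0 ?subr_ge0// ler_ln ?posrE.
Qed.

(** [gap x y] is the sum of the two relative entropies x ln (x / y) and
    y ln (y / x), each of which is jointly convex. *)
Lemma gap_mean_le (T : finType) (u v : T -> R) :
  (0 < #|T|)%N -> (forall t, 0 < u t) -> (forall t, 0 < v t) ->
  gap (mean u) (mean v) <= mean (fun t => gap (u t) (v t)).
Proof.
move=> T0 u0 v0.
have := lerD (log_sum T0 u0 v0) (log_sum T0 v0 u0).
rewrite -meanD /gap => H; apply: le_trans (le_trans H _); first by lra.
by apply: ler_mean => t; lra.
Qed.

Definition ent (T : finType) (g : T -> R) : R :=
  mean (fun t => g t * ln (g t)) - mean g * ln (mean g).

Lemma ent_card1 (T : finType) (g : T -> R) : #|T| = 1%N -> ent g = 0.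
Proof.
move=> T1; have [t0 eqt0] := fintype1 T1.
have gE t : g t = g t0 by rewrite (eqt0 t).
rewrite /ent (eq_mean (g := fun=> g t0 * ln (g t0))) => [|t]; last by rewrite gE.
by rewrite (eq_mean gE) !mean_cst ?T1// subrr.
Qed.

(** By Jensen, the entropy is at most the covariance of [h] and [ln h], and a
    covariance is half the mean product of increments over independent pairs. *)
Lemma ent_le_gap (T : finType) (h : T -> R) :
  (0 < #|T|)%N -> (forall t, 0 < h t) ->
  ent h <= mean (fun a => mean (fun b => gap (h a) (h b))) / 2.
Proof.
move=> T0 h0.
have -> : mean (fun a => mean (fun b => gap (h a) (h b))) / 2 =
    mean (fun t => h t * ln (h t)) - mean h * mean (fun t => ln (h t)).
  rewrite (eq_mean (g := fun a => (h a * ln (h a) + mean (fun b => h b * ln (h b)))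
      - (h a * mean (fun b => ln (h b)) + ln (h a) * mean h))); last first.
    move=> a; rewrite (eq_mean (g := fun b => h a * ln (h a) + h b * ln (h b)
      - (h a * ln (h b) + ln (h a) * h b))); last by move=> b; rewrite /gap; ring.
    by rewrite meanB !meanD mean_cst// !meanZ.
  by rewrite meanB !meanD mean_cst// !meanZr; lra.
by rewrite lerD2l lerN2 ler_wpM2l ?mean_ge0 ?mean_ln_le// => t; apply: ltW.
Qed.

End Mean.

(** * The modified logarithmic Sobolev inequality for transpositions *)

Section RandomTranspositions.
Context {R : realType}.

Lemma card_Sym_gt0 (n : nat) : (0 < #|{: 'S_n}|)%N.
Proof. by apply/card_gt0P; exists 1%g. Qed.

Lemma lift_perm_bij (n : nat) (i : 'I_n.+1) :
  bijective (fun p : 'I_n.+1 * 'S_n => lift_perm i p.1 p.2).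
Proof.
apply: inj_card_bij => [[a s] [b t]/= e|]; last first.
  by rewrite card_prod !card_Sn card_ord factS.
have ab : a = b by rewrite -(lift_perm_id i a s) e lift_perm_id.
subst b; congr (_, _); apply/permP => k; apply: (@lift_inj _ a).
by rewrite -!(lift_perm_lift i) e.
Qed.

Lemma mean_lift_perm (n : nat) (i : 'I_n.+1) (f : 'S_n.+1 -> R) :
  mean f = mean (fun a => mean (fun s => f (lift_perm i a s))).
Proof.
rewrite /mean -mulr_suml -mulrA -invfM -natrM !card_Sn card_ord mulnC -factS.
by rewrite pair_bigA (reindex _ (onW_bij _ (lift_perm_bij i))).
Qed.

(** Permutations sending [i] to [a] are coupled with those sending [i] to [b]
    by exchanging the values [a] and [b]. *)
Lemma mean_lift_tperm (n : nat) (i a b : 'I_n.+1) (f : 'S_n.+1 -> R) :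
  mean (fun s => f (lift_perm i b s)) =
  mean (fun s => f (lift_perm i a s * tperm a b)%g).
Proof.
(* [tperm a b] is itself [lift_perm a b w] for some [w], so right
   multiplication by it is a translation by [w] after lifting. *)
have [h _ hK] := lift_perm_bij a; have := hK (tperm a b).
case: (h _) => [c w]/= e.
have cb : c = b by rewrite -(lift_perm_id a c w) e tpermL.
rewrite (reindex_mean _ (mulIg w)); apply: eq_mean => s /=.
by rewrite -e cb lift_permM.
Qed.

(** Left multiplication by [tperm i j] exchanges the values taken by [s] at the
    positions [i] and [j]: permutations compose from left to right. *)
Definition transpo_gap (n : nat) (g : 'S_n -> R) (i j : 'I_n) : R :=
  mean (fun s : 'S_n => gap (g s) (g (tperm i j * s)%g)).

Lemma transpo_gapC (n : nat) (g : 'S_n -> R) (i j : 'I_n) :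
  transpo_gap g i j = transpo_gap g j i.
Proof. by apply: eq_mean => s; rewrite tpermC. Qed.

Lemma transpo_gapii (n : nat) (g : 'S_n -> R) (i : 'I_n) : transpo_gap g i i = 0.
Proof.
rewrite /transpo_gap (eq_mean (g := fun=> 0)) => [|s].
  by rewrite mean_cst// card_Sym_gt0.
by rewrite tperm1 mul1g gapxx.
Qed.

Lemma transpo_gap_ge0 (n : nat) (g : 'S_n -> R) (i j : 'I_n) :
  (forall s, 0 < g s) -> 0 <= transpo_gap g i j.
Proof. by move=> g0; apply: mean_ge0 => s; apply: gap_ge0. Qed.

Lemma transpo_gap_lift (n : nat) (i : 'I_n.+1) (g : 'S_n.+1 -> R) (j k : 'I_n) :
  mean (fun a => transpo_gap (fun s => g (lift_perm i a s)) j k) =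
  transpo_gap g (lift i j) (lift i k).
Proof.
rewrite /transpo_gap (mean_lift_perm i); apply: eq_mean => a; apply: eq_mean => s.
congr (gap _ (g _)); rewrite -(lift_permM i i a); congr (_ * _)%g.
apply/permP => l; case: (unliftP i l) => [l'|] ->.
  by rewrite lift_perm_lift inj_tperm//; apply: lift_inj.
by rewrite lift_perm_id tpermD // eq_sym neq_lift.
Qed.

(** Chain rule for the entropy, when the value at [i] is revealed first. *)
Lemma ent_lift_perm (n : nat) (i : 'I_n.+1) (g : 'S_n.+1 -> R) :
  ent g = mean (fun a => ent (fun s => g (lift_perm i a s)))
    + ent (fun a => mean (fun s => g (lift_perm i a s))).
Proof.
rewrite /ent meanB -!(mean_lift_perm i) -(mean_lift_perm i (fun s => g s * ln (g s))).
ring.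
Qed.

(** The value [b] to be exchanged with [a = s i] is [s j] for a unique [j], and
    [j] is uniform when [b] is: exchanging the values [a] and [b] is then
    exchanging the positions [i] and [j]. *)
Lemma ent_marginal_le (n : nat) (i : 'I_n.+1) (g : 'S_n.+1 -> R) :
  (forall s, 0 < g s) ->
  ent (fun a => mean (fun s => g (lift_perm i a s))) <=
  (\sum_j transpo_gap g i j) / (2 * n.+1%:R).
Proof.
move=> g0; apply: le_trans (ent_le_gap _ _) _; first by rewrite card_ord.
  by move=> a; apply: mean_gt0 => //; apply: card_Sym_gt0.
rewrite [X in _ <= X](_ : _ = mean (fun a => mean (fun b => mean (fun s =>
    gap (g (lift_perm i a s)) (g (lift_perm i a s * tperm a b)%g)))) / 2).
  rewrite ler_wpM2r//; apply: ler_mean => a; apply: ler_mean => b.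
  by rewrite (mean_lift_tperm i a b); apply: gap_mean_le => //; apply: card_Sym_gt0.
rewrite [2 * _]mulrC invfM mulrA; congr (_ / _).
transitivity (mean (transpo_gap g i)); first by rewrite /mean card_ord.
rewrite /transpo_gap [LHS]exchange_mean (mean_lift_perm i).
apply: eq_mean => a.
rewrite [RHS]exchange_mean; apply: eq_mean => s.
set sg := lift_perm i a s; have sgi : sg i = a by apply: lift_perm_id.
rewrite [RHS](reindex_mean _ (@perm_inj _ sg)); apply: eq_mean => j /=.
by rewrite -sgi -tpermJ -conjgC.
Qed.

(** A given pair of distinct positions is left intact by all but two of the
    [n.+1] choices of the removed position. *)
Lemma sum_lift_lift (n : nat) (A : 'I_n.+1 -> 'I_n.+1 -> R) :
  (forall i, A i i = 0) -> (forall i j, A i j = A j i) ->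
  \sum_i \sum_j \sum_k A (lift i j) (lift i k) =
  (n.+1%:R - 2) * \sum_i \sum_j A i j.
Proof.
move=> A0 AC.
rewrite (eq_bigr (fun i => \sum_j \sum_k A j k - 2 * \sum_j A i j)); last first.
  move=> i _; rewrite (bigD1_ord i)//= (bigD1_ord i (F := A i))//= A0 add0r.
  have -> : \sum_j \sum_k A (lift i j) k =
      \sum_j A i (lift i j) + \sum_j \sum_k A (lift i j) (lift i k).
    by rewrite -big_split; apply: eq_bigr => j _; rewrite (bigD1_ord i)//= AC.
  by ring.
by rewrite sumrB sumr_const card_ord -mulr_sumr -mulr_natl; ring.
Qed.

(** Summing over the revealed position, the induction closes because
    (n - 1) / n + 1 / (n + 1) <= 1. *)
Theorem mlsi_transpo (n : nat) (g : 'S_n -> R) :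
  (forall s, 0 < g s) ->
  2 * n%:R * ent g <= \sum_i \sum_j transpo_gap g i j.
Proof.
elim: n g => [|n IHn] g g0; first by rewrite mulr0 mul0r big_ord0.
have [n_eq0|n_gt0] := posnP n.
  rewrite ent_card1 ?card_Sn ?n_eq0// mulr0.
  by do 2!apply: sumr_ge0 => ? _; apply: transpo_gap_ge0.
have step i : 2 * n%:R * ent g <=
    \sum_j \sum_k transpo_gap g (lift i j) (lift i k) +
    n%:R / n.+1%:R * \sum_j transpo_gap g i j.
  rewrite (ent_lift_perm i) mulrDr lerD//.
    rewrite -meanZ; under eq_bigr do under eq_bigr do rewrite -transpo_gap_lift.
    under eq_bigr do rewrite -mean_sum.
    by rewrite -mean_sum; apply: ler_mean => a; apply: IHn.
  have -> : n%:R / n.+1%:R * \sum_j transpo_gap g i j =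
     2 * n%:R * ((\sum_j transpo_gap g i j) / (2 * n.+1%:R)).
    by field; rewrite nat1r pnatr_eq0.
  by rewrite ler_wpM2l ?ent_marginal_le// mulr_ge0.
have := ler_sum (index_enum _) (fun i (_ : true) => step i).
rewrite sumr_const card_ord -[leLHS]mulr_natr big_split/= -mulr_sumr sum_lift_lift.
- set S := \sum_i \sum_j _.
  have S0 : 0 <= S by do 2!apply: sumr_ge0 => ? _; apply: transpo_gap_ge0.
  have m0 : 0 < n%:R :> R by rewrite ltr0n.
  rewrite -(natr1 n); move: n%:R m0 => m m0 H.
  rewrite -(ler_pM2l m0).
  apply: (@le_trans _ _ ((m + 1 - 2) * S + m / (m + 1) * S)).
    by apply: le_trans H; lra.
  by rewrite -mulrDl ler_wpM2r// -lerBrDl ler_pdivrMr; nra.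
- by move=> i; apply: transpo_gapii.
- by move=> i j; apply: transpo_gapC.
Qed.

End RandomTranspositions.

(** * Exponentials *)

Section Exponentials.
Import numFieldNormedType.Exports.
Context {R : realType}.
Implicit Types a b u x : R.

(** The exponential is convex, so its integral over [0, u] is at most the
    trapezoid rule. *)
Lemma expR_trapezoid u : 0 <= u -> 2 * (expR u - 1) <= u * (expR u + 1).
Proof.
move=> u0; rewrite -subr_ge0.
pose h : R -> R := id * (expR + cst 1) - 2 *: (expR - cst 1).
have dh (v : R) : is_derive v 1 h (1 + (v - 1) * expR v).
  apply: is_derive_eq; rewrite !fctE /GRing.scale/=.  ring.
have h0 : h 0 = 0 by rewrite /h !fctE/= expR0 /GRing.scale/=; ring.
rewrite (_ : _ - _ = h u); last by rewrite /h !fctE.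
rewrite -h0; apply: (@ger0_derive1_ndecry _ h 0) => //.
- move=> v _; rewrite derive1E derive_val; have := expR_ge1Dx (- v).
  by rewrite expRN -(ler_pM2r (expR_gt0 v)) mulVf ?gt_eqF ?expR_gt0//; lra.
- apply: continuous_subspaceT => v.
  by apply: differentiable_continuous; apply/derivable1_diffP.
Qed.

Lemma gap_expR a b : gap (expR a) (expR b) = (expR a - expR b) * (a - b).
Proof. by rewrite /gap !expRK. Qed.

Lemma gap_expR_le_sym a b :
  gap (expR a) (expR b) <= (a - b) ^+ 2 * ((expR a + expR b) / 2).
Proof.
rewrite gap_expR; wlog ab : a b / b <= a.
  by move=> H; case/orP: (le_total b a) => /H//; rewrite -sqrrN; lra.
have -> : expR a = expR (a - b) * expR b by rewrite -expRD subrK.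
have u0 : 0 <= a - b by rewrite subr_ge0.
have := ler_wpM2l (mulr_ge0 u0 (expR_ge0 b)) (expR_trapezoid u0).
by move: (a - b) (expR _) (expR _) => u x y; lra.
Qed.

Lemma expRB_le a b : expR a - expR b <= expR a * (a - b).
Proof.
have := ler_wpM2l (expR_ge0 a) (expR_ge1Dx (b - a)).
by rewrite -expRD [a + _]addrC subrK; lra.
Qed.

Lemma gap_expR_le_pos a b :
  gap (expR a) (expR b) <=
  Num.max (a - b) 0 ^+ 2 * expR a + Num.max (b - a) 0 ^+ 2 * expR b.
Proof.
rewrite gap_expR; wlog ab : a b / b <= a.
  move=> H; case/orP: (le_total b a) => /H//; lra.
rewrite max_l ?subr_ge0// max_r ?subr_le0// expr0n mul0r addr0 expr2 -mulrA.
rewrite mulrC ler_wpM2l ?subr_ge0// mulrC; exact: expRB_le.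
Qed.

(** Here exp u <= 1 / (1 - u), and (1 - u) (1 + u + 2 u^2) = 1 + u^2 (1 - 2 u). *)
Lemma expR_le_quadratic u : `|u| <= 2^-1 -> expR u <= 1 + u + 2 * u ^+ 2.
Proof.
rewrite ler_norml => /andP[u1 u2].
have p : 0 < 1 - u by lra.
have : expR u * (1 - u) <= 1.
  have := ler_wpM2l (expR_ge0 u) (expR_ge1Dx (- u)).
  by rewrite -expRD subrr expR0.
rewrite -ler_pdivlMr// => /le_trans -> //.
rewrite ler_pdivrMr//; nra.
Qed.

End Exponentials.

(** * The Herbst argument *)

Section Herbst.
Context {R : realType} {T : finType}.
Hypothesis T_gt0 : (0 < #|T|)%N.
Variables (f : T -> R) (K : R).
Hypothesis K_ge0 : 0 <= K.

Let mgf (l : R) := mean (fun t => expR (l * f t)).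

Let mgf_gt0 l : 0 < mgf l.
Proof. by apply: mean_gt0 => // t; apply: expR_gt0. Qed.

Lemma ln_mgf_small (l : R) : (forall t, `|l * f t| <= 2^-1) ->
  ln (mgf l) <= l * mean f + 2 * l ^+ 2 * mean (fun t => f t ^+ 2).
Proof.
move=> small; have := ln_le_tangent (mgf_gt0 l) ltr01.
rewrite ln1 divr1 add0r => /le_trans; apply.
rewrite lerBlDr -!meanZ -meanD -[X in _ <= _ + X](mean_cst 1 T_gt0) -meanD.
apply: ler_mean => t; have := expR_le_quadratic (small t); lra.
Qed.

Hypothesis ent_le : forall l, 0 <= l ->
  ent (fun t => expR (l * f t)) <= K * l ^+ 2 * mgf l.

(** A finite-difference form of the differential inequality
    (ln (mgf l) / l)' <= K of Herbst: by the log-sum inequality, which is the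
    convexity of [ln (mgf l)], going from [l] to [r * l] costs at most
    (1 - r) l times the derivative at [l], which the entropy controls. *)
Lemma ln_mgf_step (r l : R) : r <= 1 -> 0 <= l ->
  r * ln (mgf l) <= ln (mgf (r * l)) + (1 - r) * K * l ^+ 2.
Proof.
move=> r1 l0; have e0 l' t : 0 < expR (l' * f t) := expR_gt0 _.
have := log_sum T_gt0 (e0 l) (e0 (r * l)); rewrite -/(mgf _) -/(mgf _).
rewrite [leRHS](eq_mean (g := fun t =>
    (1 - r) * (expR (l * f t) * ln (expR (l * f t))))); last first.
  by move=> t; rewrite !expRK [RHS]mulrCA mulrBl mul1r mulrA.
rewrite meanZ; have := ent_le l0; rewrite /ent -/(mgf _) lerBlDr.
have r0 : 0 <= 1 - r by rewrite subr_ge0.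
move=> /(ler_wpM2l r0) H /le_trans /(_ H).
have := mgf_gt0 l; move: (mgf l) => F F0.
rewrite (_ : (1 - r) * (_ + _) = F * ((1 - r) * (K * l ^+ 2 + ln F))); last by ring.
rewrite ler_pM2l//; lra.
Qed.

(** The errors of the steps from [r ^+ k * l] to [r ^+ k.+1 * l] form a
    geometric sum. *)
Lemma ln_mgf_iter (r l : R) (n : nat) : 0 < r -> r <= 1 -> 0 <= l ->
  r ^+ n * ln (mgf l) <=
  ln (mgf (r ^+ n * l)) + K * l ^+ 2 * r ^+ n * (1 - r ^+ n) / r.
Proof.
move=> r0 r1 l0; elim: n => [|n IHn].
  by rewrite expr0 !mul1r subrr mulr0 mul0r addr0.
have rn0 : 0 <= r ^+ n by rewrite exprn_ge0// ltW.
have := ln_mgf_step r1 (mulr_ge0 rn0 l0).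
have := ler_wpM2l (ltW r0) IHn; rewrite (exprS r n) -(mulrA r _ l).
move: (r ^+ n) (ln (mgf l)) => q x; move: (ln _) (ln _) => y z.
rewrite mulrDr (_ : r * (_ / r) = K * l ^+ 2 * q * (1 - q)); last first.
  by field; rewrite gt_eqF.
rewrite (_ : K * l ^+ 2 * (r * q) * _ / r = K * l ^+ 2 * q * (1 - r * q)).
  by lra.
by field; rewrite gt_eqF.
Qed.

(** In the iterated bound, [n] tends to infinity, where the second-order
    expansion [ln_mgf_small] applies, and then [r] tends to 1. *)
Theorem herbst (l : R) : 0 <= l -> mgf l <= expR (l * mean f + K * l ^+ 2).
Proof.
move=> l0; rewrite -[mgf l]lnK ?posrE ?mgf_gt0// ler_expR.
set C := K * l ^+ 2; have C0 : 0 <= C by rewrite mulr_ge0// sqr_ge0.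
have main r : 0 < r -> r < 1 -> ln (mgf l) <= l * mean f + C / r.
  move=> r0 r1; apply/ler_addgt0Pr => e e0.
  pose B := \sum_t `|f t|; have B0 : 0 <= B by apply: sumr_ge0.
  pose V := 2 * l ^+ 2 * mean (fun t => f t ^+ 2).
  have V0 : 0 <= V.
    rewrite mulr_ge0 ?mean_ge0 ?mulr_ge0 ?sqr_ge0// => t; exact: sqr_ge0.
  (* [d] makes the expansion valid and its quadratic term smaller than [e]. *)
  pose d := Num.min (2 * (l * B + 1))^-1 (e / (V + 1)).
  have d0 : 0 < d.
    by rewrite lt_min invr_gt0 divr_gt0// ?ltr_wpDl// mulr_gt0// ltr_wpDl// mulr_ge0.
  have [n q0 qd] : exists2 n, 0 < r ^+ n & r ^+ n < d.
    have r_norm : `|r| < 1 by rewrite gtr0_norm.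
    have /cvgrPdist_lt/(_ d d0)[n _ /(_ n (leqnn n))/=] := cvg_expr r_norm.
    by exists n; rewrite ?exprn_gt0// -[_ ^+ n]gtr0_norm ?exprn_gt0// -normrN -sub0r.
  have := ln_mgf_iter n r0 (ltW r1) l0.
  move: (r ^+ n) q0 qd => q q0; rewrite lt_min => /andP[qB qV].
  have small t : `|q * l * f t| <= 2^-1.
    have ft : `|f t| <= B by rewrite /B (bigD1 t)//= lerDl sumr_ge0.
    have lB : 0 < l * B + 1 by rewrite ltr_wpDl// mulr_ge0.
    rewrite !normrM (gtr0_norm q0) (ger0_norm l0) -mulrA.
    apply: (@le_trans _ _ (q * (l * B + 1))).
      by rewrite ler_wpM2l// ?(ltW q0)// ler_wpDr// ler_wpM2l.
    by rewrite -ler_pdivlMr// -invfM ltW.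
  have := ln_mgf_small small.
  have qVe : q * V <= e.
    apply: (@le_trans _ _ (q * (V + 1))); first by rewrite ler_wpM2l ?(ltW q0)// lerDl.
    by rewrite -ler_pdivlMr ?ltW// ltr_wpDl.
  rewrite -(ler_pM2l q0 (ln (mgf l))) -/C.
  have qC : C * q * (1 - q) / r <= q * (C / r).
    rewrite (_ : C * q * (1 - q) / r = q * (C / r) * (1 - q)); last by ring.
    have qCr0 : 0 <= q * (C / r) by rewrite mulr_ge0 ?divr_ge0// ltW.
    by rewrite -[leRHS]mulr1 ler_wpM2l// lerBlDr lerDl ltW.
  have -> : 2 * (q * l) ^+ 2 * mean (fun t => f t ^+ 2) = q * (q * V).
    by rewrite /V; ring.
  have := ler_wpM2l (ltW q0) qVe; move: (ln _) (ln _) => x y.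
  rewrite !mulrDr -/C; lra.
case: (lerP (ln (mgf l)) (l * mean f + C)) => // lt_ln.
pose A := ln (mgf l) - l * mean f; have CA : C < A by rewrite /A; lra.
have A0 : 0 < A by apply: le_lt_trans C0 CA.
have AE : ln (mgf l) = l * mean f + A by rewrite /A; ring.
clearbody A; move: main; rewrite AE => main.
(* If the claim failed, the ratio r = (A + C) / (2 A) would be admissible. *)
have AC0 : 0 < A + C by rewrite ltr_wpDr.
have /main : 0 < (A + C) / (2 * A) by rewrite divr_gt0// mulr_gt0.
rewrite ltr_pdivrMr ?mulr_gt0// mul1r invf_div lerD2l mulrA ler_pdivlMr//.
have -> : A + C < 2 * A by lra.
move=> /(_ isT); nra.
Qed.

Theorem chernoff (t l : R) : 0 <= l ->
  mean (fun s => (t <= f s - mean f)%R%:R) <= expR (K * l ^+ 2 - l * t).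
Proof.
move=> l0; rewrite (_ : K * l ^+ 2 - l * t =
  (l * mean f + K * l ^+ 2) + (- (l * (mean f + t)))); last by ring.
rewrite expRD; apply: le_trans (ler_wpM2r (expR_ge0 _) (herbst l0)).
rewrite -meanZr; apply: ler_mean => s; rewrite -expRD.
case: (boolP (t <= _)) => [ts|_]; last exact: expR_ge0.
rewrite -expR0 ler_expR -mulrBr mulr_ge0//; lra.
Qed.

End Herbst.

(** * Descents of a convex Lipschitz function under exchanges *)

Section ConvexLipschitz.
Context {R : realType}.

(** Jensen for finitely many points, as a bound on the displacement from [w].
    The weights sum to less than 1, so that the weight left to [w] stays
    positive and the induction can divide by [1 - p i]. *)
Lemma conv_sum_le (E : lmodType R) (D : set E) (f : E -> R)
    (f_conv : forall x y (t : R), D x -> D y -> 0 <= t <= 1 ->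
      D (t *: x + (1 - t) *: y) /\
      f (t *: x + (1 - t) *: y) <= t * f x + (1 - t) * f y)
    (I : Type) (r : seq I) (w : E) (y : I -> E) (p : I -> R) :
  D w -> (forall i, D (y i)) -> (forall i, 0 <= p i) -> \sum_(i <- r) p i < 1 ->
  D (w + \sum_(i <- r) p i *: (y i - w)) /\
  f (w + \sum_(i <- r) p i *: (y i - w)) <=
    f w + \sum_(i <- r) p i * (f (y i) - f w).
Proof.
move=> Dw Dy; elim: r p => [|i r IHr] p p0; first by rewrite !big_nil !addr0.
rewrite !big_cons => p1.
have S0 : 0 <= \sum_(j <- r) p j by apply: sumr_ge0.
have pi0 := p0 i.
have q0 : 0 < 1 - p i by lra.
pose p' j := p j / (1 - p i).
have pE j : p j = (1 - p i) * p' j by rewrite mulrC divfK ?gt_eqF.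
have [||Dz fz] := IHr p'.
- by move=> j; rewrite divr_ge0// ltW.
- by rewrite -mulr_suml ltr_pdivrMr//; lra.
have pi01 : 0 <= p i <= 1 by apply/andP; split; lra.
have [Dv fv] := f_conv _ _ (p i) (Dy i) Dz pi01.
have vE : w + (p i *: (y i - w) + \sum_(j <- r) p j *: (y j - w)) =
    p i *: y i + (1 - p i) *: (w + \sum_(j <- r) p' j *: (y j - w)).
  rewrite [in RHS]scalerDr scaler_sumr; under [in RHS]eq_bigr do rewrite scalerA -pE.
  rewrite !addrA; congr (_ + _).
  by rewrite scalerBr scalerBl scale1r addrC -!addrA; congr (_ + _); rewrite addrC.
rewrite vE; split=> //; apply: le_trans fv _.
have := ler_wpM2l (ltW q0) fz; rewrite mulrDr mulr_sumr.
under [in X in _ <= X -> _]eq_bigr do rewrite mulrA -pE.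
by move: (\sum_(j <- r) p j * _) (f (w + _)) => s z; lra.
Qed.

Lemma sqr_sum_le (n : nat) (a : 'I_n -> R) :
  (\sum_i a i) ^+ 2 <= n%:R * \sum_i a i ^+ 2.
Proof.
rewrite expr2 mulr_suml.
apply: (@le_trans _ _ (\sum_i \sum_j (a i ^+ 2 + a j ^+ 2) / 2)).
  apply: ler_sum => i _; rewrite mulr_sumr; apply: ler_sum => j _.
  have := sqr_ge0 (a i - a j); lra.
set S := \sum_i a i ^+ 2.
rewrite (eq_bigr (fun i => n%:R * a i ^+ 2 / 2 + S / 2)) => [|i _].
  rewrite big_split/= sumr_const card_ord -mulr_suml -mulr_sumr.
  by rewrite -[_ *+ n]mulr_natl -/S; lra.
by rewrite -mulr_suml big_split/= sumr_const card_ord -[_ *+ n]mulr_natl -/S; lra.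
Qed.

Lemma xcol_coord (N : nat) (w : 'rV[R]_N) (i j k : 'I_N) :
  (xcol i j w - w) 0 k =
  (i == k)%:R * (w 0 j - w 0 k) + (j == k)%:R * (w 0 i - w 0 k).
Proof.
rewrite !mxE; case: tpermP => [->|->|].
- by rewrite eqxx mul1r; case: eqVneq => [->|]; rewrite ?subrr ?mul0r ?mulr0 addr0.
- by rewrite eqxx mul1r; case: eqVneq => [->|]; rewrite ?subrr ?mul0r ?mulr0 add0r.
- move=> /eqP ki /eqP kj.
  by rewrite (eq_sym i) (negbTE ki) (eq_sym j) (negbTE kj) !mul0r addr0 subrr.
Qed.

(** This replaces the bound by the gradient of [f], which need not exist on the
    boundary of the cube, by a move in one well chosen direction. *)
Lemma sum_sqr_descent (N : nat) (a b : R) (f : 'rV[R]_N -> R) (w : 'rV[R]_N) :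
  convex_function (cube a b) f -> elipschitz1 (cube a b) f -> cube a b w ->
  \sum_i \sum_j Num.max (f w - f (xcol i j w)) 0 ^+ 2 <=
  4 * N%:R * (b - a) ^+ 2.
Proof.
move=> fconv flip Cw.
pose d i j := Num.max (f w - f (xcol i j w)) 0.
have d0 i j : 0 <= d i j by rewrite le_max lexx orbT.
have dC i j : d i j = d j i by rewrite /d /xcol tpermC.
have dE i j : d i j * (f (xcol i j w) - f w) = - d i j ^+ 2.
  rewrite /d; case: (lerP (f w - f (xcol i j w)) 0) => _; last by ring.
  by rewrite mul0r expr0n oppr0.
pose T := \sum_i \sum_j d i j ^+ 2; rewrite -/T.
pose U := \sum_i \sum_j d i j.
have U0 : 0 <= U by do 2!apply: sumr_ge0 => ? _.
(* Any step [e] with [e * U < 1] will do: the bound does not depend on it. *)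
pose e := (U + 1)^-1; have e0 : 0 < e by rewrite invr_gt0 ltr_wpDl.
have eU : e * U < 1 by rewrite mulrC ltr_pdivrMr ?ltr_wpDl// mul1r ltrDl.
have Cx i j : cube a b (xcol i j w) by move=> k; rewrite mxE; apply: Cw.
have cf x y (t : R) : cube a b x -> cube a b y -> 0 <= t <= 1 ->
    cube a b (t *: x + (1 - t) *: y) /\
    f (t *: x + (1 - t) *: y) <= t * f x + (1 - t) * f y.
  move=> Cx' Cy /andP[t0 t1]; split.
    move=> k; rewrite !mxE; have /andP[x1 x2] := Cx' k; have /andP[y1 y2] := Cy k.
    by apply/andP; split; nra.
  have := fconv (Itv01 t0 t1) x y; rewrite !inE => /(_ Cx' Cy).
  by rewrite convRE.
pose u := \sum_i \sum_j (e * d i j) *: (xcol i j w - w).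
have [Cu fu] : cube a b (w + u) /\ f (w + u) <= f w - e * T.
  have [|||] := @conv_sum_le _ _ _ cf ('I_N * 'I_N)%type (index_enum _) w
    (fun p => xcol p.1 p.2 w) (fun p => e * d p.1 p.2) Cw.
  - by move=> p; apply: Cx.
  - by move=> p; rewrite mulr_ge0// ltW.
  - by rewrite -mulr_sumr -(pair_bigA _ (fun i j => d i j)).
  rewrite -(pair_bigA _ (fun i j => (e * d i j) *: (xcol i j w - w)))/= -/u.
  rewrite -(pair_bigA _ (fun i j => e * d i j * (f (xcol i j w) - f w)))/=.
  move=> Cu; rewrite (_ : \sum_i _ = - (e * T)); first by split.
  rewrite mulr_sumr -sumrN; apply: eq_bigr => i _.
  rewrite mulr_sumr -sumrN; apply: eq_bigr => j _.
  by rewrite -mulrA dE mulrN.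
have delta (k : 'I_N) (c : 'I_N -> R) : \sum_i (i == k)%:R * c i = c k.
  rewrite (bigD1 k)//= eqxx mul1r big1 ?addr0// => i /negbTE ->.
  by rewrite mul0r.
have uE k : u 0 k = 2 * e * \sum_j d k j * (w 0 j - w 0 k).
  transitivity (\sum_i (i == k)%:R * (\sum_j e * d i j * (w 0 j - w 0 k)) +
      \sum_j (j == k)%:R * (\sum_i e * d i j * (w 0 i - w 0 k))).
    under [X in _ = _ + X]eq_bigr do rewrite mulr_sumr.
    rewrite summxE [X in _ = _ + X]exchange_big -big_split/=; apply: eq_bigr => i _.
    rewrite summxE mulr_sumr -big_split/=; apply: eq_bigr => j _.
    by rewrite mxE xcol_coord; ring.
  rewrite !delta mulr_sumr -big_split/=; apply: eq_bigr => j _.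
  by rewrite (dC j k); ring.
have unorm : \sum_k u 0 k ^+ 2 <= e ^+ 2 * (4 * N%:R * (b - a) ^+ 2 * T).
  rewrite !mulr_sumr; apply: ler_sum => k _; rewrite uE exprMn.
  apply: (@le_trans _ _
    ((2 * e) ^+ 2 * (N%:R * \sum_j (d k j * (w 0 j - w 0 k)) ^+ 2))).
    by rewrite ler_wpM2l ?sqr_ge0// sqr_sum_le.
  rewrite [leRHS](_ : _ =
    (2 * e) ^+ 2 * (N%:R * ((b - a) ^+ 2 * \sum_j d k j ^+ 2))); last by ring.
  rewrite ler_wpM2l ?sqr_ge0// ler_wpM2l// mulr_sumr; apply: ler_sum => j _.
  rewrite exprMn mulrC ler_wpM2r ?sqr_ge0// -real_normK ?num_real//.
  have /andP[j1 j2] := Cw j; have /andP[k1 k2] := Cw k.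
  by rewrite lerXn2r ?nnegrE ?normr_ge0// ?ler_norml; [lra|apply/andP; split; lra].
have T0 : 0 <= T by do 2!apply: sumr_ge0 => ? _; apply: sqr_ge0.
have eT : e * T <= enorm u.
  have := flip w (w + u) Cw Cu; have -> : enorm (w - (w + u)) = enorm u.
    congr Num.sqrt; apply: eq_bigr => k _.
    by rewrite opprD addrA subrr sub0r mxE sqrrN.
  by apply: le_trans; apply: le_trans (ler_norm _); lra.
have : (e * T) ^+ 2 <= enorm u ^+ 2.
  by rewrite lerXn2r// nnegrE ?sqrtr_ge0// mulr_ge0// ltW.
rewrite sqr_sqrtr ?sumr_ge0// => [/le_trans/(_ unorm)|k _]; last exact: sqr_ge0.
rewrite exprMn ler_pM2l ?exprn_gt0// expr2.
have [->|/eqP T_neq0] := eqVneq T 0.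
  by move=> _; rewrite mulr_ge0 ?sqr_ge0// mulr_ge0.
by rewrite ler_pM2r// lt_def T0 andbT; apply/eqP.
Qed.

End ConvexLipschitz.

(** * The multislice as an orbit of the symmetric group *)

Section Multislice.
Context {R : realType} {L N : nat} (kappa : 'I_L -> nat) (x : 'I_L -> R).

Local Notation Omega := (multislice N kappa x).

Lemma multisliceP (w : 'rV[R]_N) :
  reflect ((exists s : 'I_N -> 'I_L, forall i, w 0 i = x (s i)) /\
           (forall l, #|[set i : 'I_N | w 0 i == x l]| = kappa l))
          (w \in Omega).
Proof.
rewrite /multislice !inE/=; apply: (iffP andP).
  move=> [/imfsetP[s _ ->] /forallP H]; split; last by move=> l; apply/eqP.
  by exists s => i; rewrite mxE.
move=> [[s ws] H]; split; last by apply/forallP => l; apply/eqP.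
apply/imfsetP; exists [ffun i => s i] => //.
by apply/rowP => i; rewrite mxE ffunE.
Qed.

Lemma col_perm_multislice (s : 'S_N) (w : 'rV[R]_N) :
  w \in Omega -> col_perm s w \in Omega.
Proof.
move=> /multisliceP[[v wv] H]; apply/multisliceP; split.
  by exists (v \o s) => i; rewrite mxE wv.
move=> l; rewrite -(H l) -[RHS](card_preimset _ (@perm_inj _ s)).
by apply: eq_card => i; rewrite !inE mxE.
Qed.

Lemma multislice_transitive (w0 w : 'rV[R]_N) :
  w0 \in Omega -> w \in Omega -> exists s : 'S_N, w = col_perm s w0.
Proof.
move=> /multisliceP[[v0 wv0] H0] /multisliceP[[v wv] H].
have /tuple_permP[s ws] : perm_eq [tuple w 0 i | i < N] [tuple w0 0 i | i < N].
  apply/allP => y _ /=; apply/eqP.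
  have cE (z : 'rV[R]_N) : count_mem y [tuple z 0 i | i < N] =
      #|[set i | z 0 i == y]|.
    rewrite /= count_map cardsE cardE size_filter -enumT; apply: eq_count => i.
    by rewrite !inE.
  rewrite !cE; case: (pickP (fun l => y == x l)) => [l /eqP ->|ny].
    by rewrite H H0.
  have n0 (z : 'rV[R]_N) (u : 'I_N -> 'I_L) : (forall i, z 0 i = x (u i)) ->
      #|[set i | z 0 i == y]| = 0%N.
    by move=> zu; apply: eq_card0 => i; rewrite !inE zu eq_sym ny.
  by rewrite (n0 w v)// (n0 w0 v0).
exists s; apply/rowP => i; rewrite mxE.
have := congr1 (fun t => nth 0 t i) ws.
by rewrite -!tnth_nth !tnth_mktuple.
Qed.

(** By transitivity the average of [phi] along an orbit does not depend on the
    starting point, so it can be averaged over the multislice, which every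
    permutation preserves. *)
Lemma unif_expect_perm (w0 : 'rV[R]_N) (phi : 'rV[R]_N -> R) :
  w0 \in Omega ->
  unif_expect Omega phi = mean (fun s : 'S_N => phi (col_perm s w0)).
Proof.
move=> w0O; set m := mean _.
have Omega_neq0 : (#|` Omega|%:R : R) != 0.
  by rewrite pnatr_eq0 cardfs_eq0; apply/fset0Pn; exists w0.
apply: (canLR (mulfK Omega_neq0)).
have orbit_mean w : w \in Omega -> mean (fun s : 'S_N => phi (col_perm s w)) = m.
  move=> /(multislice_transitive w0O)[p ->].
  rewrite /m [RHS](reindex_mean _ (mulIg p)); apply: eq_mean => s /=.
  by rewrite col_permM.
have shift_sum (s : 'S_N) : \sum_(w <- Omega) phi (col_perm s w) =
    \sum_(w <- Omega) phi w.
  rewrite -(big_map (col_perm s) xpredT phi); apply: perm_big.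
  have col_permK : cancel (@col_perm R 1 N s) (col_perm s^-1%g).
    by move=> w; rewrite -col_permM mulVg col_perm1.
  apply: uniq_perm; rewrite ?fset_uniq//.
    by rewrite map_inj_uniq ?fset_uniq//; apply: can_inj col_permK.
  move=> w; apply/mapP/idP => [[v vO ->]|wO]; first exact: col_perm_multislice.
  exists (col_perm s^-1%g w); first exact: col_perm_multislice.
  by rewrite -col_permM mulgV col_perm1.
transitivity (\sum_(w <- Omega) mean (fun s : 'S_N => phi (col_perm s w))).
  by rewrite -mean_sum (eq_mean shift_sum) mean_cst// card_Sym_gt0.
rewrite (eq_big_seq (fun=> m)) ?big_const_seq ?count_predT ?iter_addr_0//.
by rewrite mulr_natr.
Qed.

Lemma unif_probE (A : pred 'rV[R]_N) :
  unif_prob Omega A = unif_expect Omega (fun w => (A w)%:R) :> R.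
Proof.
rewrite /unif_prob /unif_expect; congr (_ / _).
rewrite card_fset_sum1 -big_fset_condE natr_sum big_mkcond/=.
by apply: eq_bigr => w _; case: (A w).
Qed.

End Multislice.

(** * Concentration *)

Section Concentration.
Context {R : realType}.

Lemma sum_sym_lt (n : nat) (A : 'I_n -> 'I_n -> R) :
  (forall i, A i i = 0) -> (forall i j, A i j = A j i) ->
  \sum_i \sum_j A i j = 2 * \sum_(i < n) \sum_(j < n | (i < j)%N) A i j.
Proof.
move=> A0 AC; set S := \sum_(i < n) \sum_(j < n | (i < j)%N) _.
have -> : 2 * S = S + \sum_(i < n) \sum_(j < n | (j < i)%N) A i j.
  rewrite (exchange_big_dep xpredT)//=.
  under [X in _ = _ + X]eq_bigr do under eq_bigr do rewrite AC.
  by rewrite mulr2n mulrDl mul1r.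
rewrite -big_split; apply: eq_bigr => i _.
rewrite (bigID (fun j : 'I_n => (i < j)%N))/=; congr (_ + _).
rewrite (bigD1 i) ?ltnn//= A0 add0r; apply: eq_bigl => j.
by rewrite -leqNgt ltn_neqAle andbC.
Qed.

Section Permutations.
Variables (n : nat) (F : 'S_n -> R).

(** Both exponentials have the same mean, so the half-sum in [gap_expR_le_sym]
    averages to the mean of one of them. *)
Lemma transpo_gap_expR_le (i j : 'I_n) (c l : R) :
  (forall s, `|F s - F (tperm i j * s)%g| <= c) ->
  transpo_gap (fun s => expR (l * F s)) i j <=
  l ^+ 2 * c ^+ 2 * mean (fun s => expR (l * F s)).
Proof.
move=> Fc; rewrite [leRHS](_ : _ = mean (fun s => l ^+ 2 * c ^+ 2 *
    ((expR (l * F s) + expR (l * F (tperm i j * s)%g)) / 2))).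
  apply: ler_mean => s; apply: le_trans (gap_expR_le_sym _ _) _.
  rewrite ler_wpM2r ?divr_ge0 ?addr_ge0 ?expR_ge0// -mulrBr exprMn.
  rewrite ler_wpM2l ?sqr_ge0// -real_normK ?num_real//.
  by rewrite lerXn2r ?nnegrE ?normr_ge0//; apply: le_trans (Fc s).
rewrite meanZ meanZr meanD.
rewrite -(reindex_mean (fun s => expR (l * F s)) (mulgI (tperm i j))).
by congr (_ * _); lra.
Qed.

(** By the symmetry between [s] and [tperm i j * s] only the descents of [F]
    count, each weighted by the larger of the two exponentials. *)
Lemma transpo_gap_expR_le_pos (i j : 'I_n) (l : R) : 0 <= l ->
  transpo_gap (fun s => expR (l * F s)) i j <=
  2 * l ^+ 2 * mean (fun s =>
    Num.max (F s - F (tperm i j * s)%g) 0 ^+ 2 * expR (l * F s)).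
Proof.
move=> l0; pose D s := Num.max (F s - F (tperm i j * s)%g) 0 ^+ 2 * expR (l * F s).
rewrite -/(mean D).
rewrite [leRHS](_ : _ = l ^+ 2 * (mean D + mean (D \o mulg (tperm i j)))).
  rewrite -meanD -meanZ; apply: ler_mean => s; apply: le_trans (gap_expR_le_pos _ _) _.
  rewrite /D /= mulgA tperm2 mul1g -!mulrBr.
  by rewrite -[0](mulr0 l) -!maxr_pMr// mulr0 !exprMn; lra.
by rewrite -(reindex_mean D (mulgI (tperm i j))); ring.
Qed.

Theorem perm_concentration (K t l : R) : (0 < n)%N -> 0 <= K ->
  (forall l, 0 <= l -> \sum_i \sum_j transpo_gap (fun s => expR (l * F s)) i j <=
    2 * n%:R * (K * l ^+ 2 * mean (fun s => expR (l * F s)))) ->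
  0 <= l ->
  mean (fun s => (t <= F s - mean F)%R%:R) <= expR (K * l ^+ 2 - l * t).
Proof.
move=> n0 K0 H; apply: chernoff => //; first exact: card_Sym_gt0.
move=> l' l'0; rewrite -(ler_pM2l (_ : 0 < 2 * n%:R)) ?mulr_gt0 ?ltr0n//.
by apply: le_trans (H _ l'0); apply: mlsi_transpo => s; apply: expR_gt0.
Qed.

End Permutations.

(** The optimal parameter is l = t / (2 K). *)
Lemma chernoff_optimum (P K t : R) : 0 < K -> 0 <= t ->
  (forall l, 0 <= l -> P <= expR (K * l ^+ 2 - l * t)) ->
  P <= expR (- (t ^+ 2 / (4 * K))).
Proof.
move=> K0 t0 /(_ (t / (2 * K))) H.
rewrite (_ : - _ = K * (t / (2 * K)) ^+ 2 - t / (2 * K) * t).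
  by apply: H; rewrite divr_ge0// mulr_ge0// ltW.
by field; rewrite gt_eqF.
Qed.

End Concentration.

Lemma unif_prob0 (R : realType) (T : choiceType) (S : {fset T}) (A : pred T) :
  S = fset0 -> unif_prob S A = 0 :> R.
Proof. by move=> ->; rewrite /unif_prob cardfs0 invr0 mulr0. Qed.

Section MultisliceConcentration.
Context {R : realType} {L N : nat} (kappa : 'I_L -> nat) (x : 'I_L -> R).
Local Notation Omega := (multislice N kappa x).
Hypothesis N_gt0 : (0 < N)%N.

Lemma multislice_concentration (f : 'rV[R]_N -> R) (K t l : R) : 0 <= K ->
  (forall w l, w \in Omega -> 0 <= l ->
    \sum_i \sum_j transpo_gap (fun s : 'S_N => expR (l * f (col_perm s w))) i j <=
    2 * N%:R * (K * l ^+ 2 * mean (fun s : 'S_N => expR (l * f (col_perm s w))))) ->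
  0 <= l ->
  unif_prob Omega (fun w => t <= f w - unif_expect Omega f) <=
    expR (K * l ^+ 2 - l * t).
Proof.
move=> K0 H l0; case: (fset_0Vmem Omega) => [empty | [w wO]].
  by rewrite unif_prob0// expR_ge0.
rewrite unif_probE !(unif_expect_perm _ wO).
by apply: perm_concentration => // l' l'0; apply: H.
Qed.

Lemma multislice_lip_concentration (f : 'rV[R]_N -> R) (c : 'I_N -> 'I_N -> R)
    (t l : R) :
  (forall w, w \in Omega -> forall i j : 'I_N, (i < j)%N ->
     `|f w - f (xcol i j w)| <= c i j) ->
  0 <= l ->
  unif_prob Omega (fun w => t <= f w - unif_expect Omega f) <=
    expR ((\sum_(i < N) \sum_(j < N | (i < j)%N) c i j ^+ 2) / N%:R * l ^+ 2
      - l * t).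
Proof.
move=> fc; set S := \sum_(i < N) _; apply: multislice_concentration.
  by rewrite divr_ge0//; do 2!apply: sumr_ge0 => ? _; apply: sqr_ge0.
move=> w l' wO l'0; rewrite sum_sym_lt; last 2 first.
- by move=> i; apply: transpo_gapii.
- by move=> i j; apply: transpo_gapC.
set m := mean _.
have -> : 2 * N%:R * (S / N%:R * l' ^+ 2 * m) = 2 * (l' ^+ 2 * S * m).
  by field; rewrite pnatr_eq0 -lt0n.
rewrite ler_wpM2l// mulr_sumr mulr_suml; apply: ler_sum => i _.
rewrite mulr_sumr mulr_suml; apply: ler_sum => j ij.
apply: transpo_gap_expR_le => s; rewrite col_permM.
by apply: fc => //; apply: col_perm_multislice.
Qed.

Lemma multislice_convex_concentration (a b : R) (f : 'rV[R]_N -> R) (t l : R) :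
  (forall w, w \in Omega -> cube a b w) ->
  convex_function (cube a b) f -> elipschitz1 (cube a b) f ->
  0 <= l ->
  unif_prob Omega (fun w => t <= f w - unif_expect Omega f) <=
    expR (4 * (b - a) ^+ 2 * l ^+ 2 - l * t).
Proof.
move=> Oab fconv flip; apply: multislice_concentration.
  by rewrite mulr_ge0 ?sqr_ge0.
move=> w l' wO l'0.
pose D i j (s : 'S_N) :=
  Num.max (f (col_perm s w) - f (xcol i j (col_perm s w))) 0 ^+ 2.
apply: (@le_trans _ _ (2 * l' ^+ 2 * \sum_i \sum_j
    mean (fun s => D i j s * expR (l' * f (col_perm s w))))).
  rewrite mulr_sumr; apply: ler_sum => i _; rewrite mulr_sumr; apply: ler_sum => j _.
  apply: le_trans (transpo_gap_expR_le_pos _ _ _ l'0) _.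
  by rewrite ler_wpM2l ?mulr_ge0 ?sqr_ge0//; apply: ler_mean => s; rewrite col_permM.
under eq_bigr do rewrite -mean_sum.
rewrite -mean_sum (_ : 2 * N%:R * _ = 2 * l' ^+ 2 * mean (fun s : 'S_N =>
    4 * N%:R * (b - a) ^+ 2 * expR (l' * f (col_perm s w)))); last first.
  by rewrite meanZ; ring.
rewrite ler_wpM2l ?mulr_ge0 ?sqr_ge0//; apply: ler_mean => s.
under eq_bigr do rewrite -mulr_suml.
rewrite -mulr_suml ler_wpM2r ?expR_ge0//; apply: sum_sqr_descent => //.
by apply: Oab; apply: col_perm_multislice.
Qed.

End MultisliceConcentration.

(* [xcol i j w] is the vector w with its i-th and j-th components exchanged.
   The bound of the first part is computed in [\bar R], where 1 / 0 = +oo,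
   0 * +oo = 0 and [expeR -oo = 0]: this is what it means when all c_ij = 0. *)
Theorem proposition1p1 (R : realType) (L : nat) (hL : (2 <= L)%N)
    (kappa : 'I_L -> nat) (kappa_gt0 : forall l, (0 < kappa l)%N)
    (N : nat) (hN : N = (\sum_(l < L) kappa l)%N)
    (x : 'I_L -> R) (x_incr : forall l m : 'I_L, (l < m)%N -> x l < x m) :
  let Omega : {fset 'rV[R]_N} := multislice N kappa x in
  (forall (f : 'rV[R]_N -> R) (c : 'I_N -> 'I_N -> R),
     (forall i j : 'I_N, (i < j)%N -> 0 <= c i j) ->
     (forall w : 'rV[R]_N, w \in Omega -> forall i j : 'I_N, (i < j)%N ->
        `|f w - f (xcol i j w)| <= c i j) ->
     forall t : R, 0 <= t ->
       ((unif_prob Omega (fun w => t <= f w - unif_expect Omega f))%:E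
        <= expeR (- ((N%:R * t ^+ 2)%:E /
             (4 * \sum_(i < N) \sum_(j < N | (i < j)%N) c i j ^+ 2)%:E)))%E)
  /\
  (forall f : 'rV[R]_N -> R,
     convex_function (cube (x (idx_first hL)) (x (idx_last hL))) f ->
     elipschitz1 (cube (x (idx_first hL)) (x (idx_last hL))) f ->
     forall t : R, 0 <= t ->
       unif_prob Omega (fun w => t <= f w - unif_expect Omega f)
       <= expR (- (t ^+ 2 / (16 * diam hL x ^+ 2)))).
Proof.
move=> Omega.
have N_gt0 : (0 < N)%N.
  by rewrite hN (bigD1 (idx_first hL))//= addn_gt0 kappa_gt0.
split=> [f c c_ge0 fc t t_ge0|f fconv flip t t_ge0].
  have bound l := @multislice_lip_concentration _ _ _ kappa x N_gt0 f c t l fc.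
  move: bound; rewrite -/Omega; set S := \sum_(i < N) _ => bound.
  have S_ge0 : 0 <= S by do 2!apply: sumr_ge0 => ? _; apply: sqr_ge0.
  have [S_eq0|S_neq0] := eqVneq S 0; last first.
    have S_gt0 : 0 < S by rewrite lt_def S_neq0.
    have N0 : 0 < N%:R :> R by rewrite ltr0n.
    rewrite inver mulf_eq0 pnatr_eq0/= (negbTE S_neq0) lee_fin.
    rewrite (_ : N%:R * t ^+ 2 / (4 * S) = t ^+ 2 / (4 * (S / N%:R))); last first.
      by field; rewrite !gt_eqF.
    apply: chernoff_optimum => [|//|l]; first by rewrite divr_gt0.
    exact: bound.
  rewrite S_eq0 mulr0 inve0; have [t_eq0|t_neq0] := eqVneq t 0.
    rewrite [t ^+ 2](_ : _ = 0) ?t_eq0 ?expr0n// mulr0 mul0e oppe0 expeR0 lee_fin.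
    by have := bound 0 (lexx 0); rewrite t_eq0 expr0n mulr0 mul0r subrr expR0.
  (* All c_ij vanish and t > 0: the bound exp (- l t) for every l forces the
     probability to be 0; l = 1 / (P t) suffices for a contradiction. *)
  rewrite gt0_muley ?lte_fin ?mulr_gt0 ?ltr0n ?exprn_gt0 ?lt_def ?t_neq0//=.
  rewrite lee_fin leNgt; apply/negP; move: bound; rewrite S_eq0.
  set P := unif_prob _ _ => bound P_gt0.
  have t_gt0 : 0 < t by rewrite lt_def t_neq0.
  have Pt_gt0 : 0 < P * t by rewrite mulr_gt0.
  have := bound (P * t)^-1; rewrite invr_ge0 ltW// => /(_ isT).
  rewrite !mul0r sub0r invfM mulfVK// expRN -(ler_pM2r (expR_gt0 P^-1)).
  rewrite mulVf ?gt_eqF ?expR_gt0// leNgt => /negP; apply.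
  apply: (@lt_le_trans _ _ (P * (1 + P^-1))).
    by rewrite mulrDr mulr1 mulfV ?gt_eqF// ltrDr.
  by rewrite ler_wpM2l ?(ltW P_gt0)// expR_ge1Dx.
have le_x (l m : 'I_L) : (l <= m)%N -> x l <= x m.
  by rewrite leq_eqVlt => /predU1P[/ord_inj->//|/x_incr/ltW].
have Omega_cube w : w \in Omega -> cube (x (idx_first hL)) (x (idx_last hL)) w.
  move=> /multisliceP[[s ws] _] i; rewrite ws !le_x//=.
  by rewrite subn1 -ltnS prednK ?ltn_ord// (leq_trans _ hL).
rewrite (_ : 16 * _ = 4 * (4 * diam hL x ^+ 2)); last by ring.
apply: chernoff_optimum => // [|l l0]; last exact: multislice_convex_concentration.
rewrite mulr_gt0// exprn_gt0// subr_gt0; apply: x_incr.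
by rewrite /= subn1 -ltnS prednK ?(leq_trans _ hL).
Qed.
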